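(* Let $G$ be a nilpotent group, $H$ a subgroup of finite index $m$ in $G$, $f\in \mathrm{Hom}(H,G)$ a homomorphism, and $L$ the $f$-core of $H$. Then $\ker(f)\leq \sqrt[H]{L}$.
   Context: For $K\leq H$, write $K^f$ for the image of $K$ under $f$. A subgroup $K$ of $H$ is $f$-invariant if $K^f\leq K$. The $f$-core of $H$ is the largest subgroup $K$ of $H$ which is normal in $G$ and $f$-invariant. The isolator of $L$ in $H$ is $\sqrt[H]{L}=\{x\in H \mid x^n\in L \text{ for some positive integer } n\}$. *)

(* Defs.v *)
From mathcomp Require Import all_boot.
From mathcomp Require Import boolp classical_sets functions cardinality.

Set Implicit Arguments.
Unset Strict Implicit.
Unset Printing Implicit Defensive.

Local Open Scope classical_set_scope.
Local Open Scope group_scope.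

(* Groups may be infinite: the ambient group is a [groupType], and its
   subgroups are Prop-valued subsets of the carrier. *)

Section Subgroups.
Context {G : groupType}.
Implicit Types (K H L A : set G).

Definition subgroup K : Prop :=
  [/\ K 1, forall x y, K x -> K y -> K (x * y) & forall x, K x -> K x^-1].

Definition normal_subset K : Prop := forall x g, K x -> K (x ^ g).

Definition right_cosets H : set (set G) :=
  range (fun x => [set h * x | h in H]).

Definition has_index H (m : nat) : Prop := (right_cosets H #= `I_m)%card.

(* A homomorphism from H to G is given by a total function of which only the
   values on H matter. *)
Definition homomorphism_on H (f : G -> G) : Prop :=
  forall x y, H x -> H y -> f (x * y) = f x * f y.

Definition kernel_on H (f : G -> G) : set G := [set x | H x /\ f x = 1].

Definition f_invariant (f : G -> G) K : Prop := f @` K `<=` K.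

Definition core_candidate H (f : G -> G) K : Prop :=
  [/\ subgroup K, K `<=` H, normal_subset K & f_invariant f K].

Definition is_fcore H (f : G -> G) L : Prop :=
  core_candidate H f L /\ forall K, core_candidate H f K -> K `<=` L.

Definition isolator H L : set G :=
  [set x | H x /\ exists n : nat, (0 < n)%N /\ L (x ^+ n)].

Definition generated A : set G := smallest subgroup A.

(* [lower_central n] is the term usually written gamma_(n+1)(G). *)
Fixpoint lower_central (n : nat) : set G :=
  if n is n'.+1 then
    generated [set z | exists x y : G, lower_central n' x /\ z = [~ x, y]]
  else setT.

End Subgroups.

Definition nilpotent_group (G : groupType) : Prop :=
  exists c : nat, lower_central c = [set (1 : G)].

(* Main.v *)
(* Write K for the kernel of f, which is normal in H.  Put A_0 = K^G, the normal
   closure of K in G, and A_(k+1) = [A_k, G]; these subgroups reach 1 because G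
   is nilpotent.  By induction on k, every element of A_k has a positive power
   in (K `&` A_k) A_(k+1): commutation A_k x G -> A_(k+1) / A_(k+2) is
   bimultiplicative, and [K, g^M] lies in K as soon as g^M lies in H.
   Descending along the A_k, every element of K^G has a positive power in K.
   As K has only finitely many conjugates in G, some positive power of a given
   x in K lies in all of them.  Their intersection is normal in G, is contained
   in H, and is killed by f, so it is contained in the f-core. *)

Require Import Defs.
From mathcomp Require Import all_boot.
From mathcomp Require Import boolp classical_sets functions cardinality.

Local Open Scope classical_set_scope.
Local Open Scope group_scope.

(** * Generated subgroups, normal closures and commutators with the whole group *)

Section SubgroupTheory.
Variable G : groupType.
Implicit Types (A K H N : set G) (x y z g : G).

Lemma subgroupX H x n : subgroup H -> H x -> H (x ^+ n).
Proof.
move=> [H1 HM _] Hx; elim: n => [|n IHn]; first by rewrite expg0.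
by rewrite expgS; apply: HM.
Qed.

Lemma sub_generated A : A `<=` generated A.
Proof. exact: sub_gen_smallest. Qed.

Lemma generated_sub A H : subgroup H -> A `<=` H -> generated A `<=` H.
Proof. exact: smallest_sub. Qed.

Lemma subgroup_generated A : subgroup (generated A).
Proof.
split=> [M [[M1 _ _] _] //|x y Ax Ay M MP|x Ax M MP].
  by have [[_ MM _] _] := MP; apply: MM; [apply: Ax | apply: Ay].
by have [[_ _ MV] _] := MP; apply: MV; apply: Ax.
Qed.

(** Conjugation by [g] is an endomorphism. Through this, normality of a generated subgroup is tested
    on generators. *)
Lemma subgroup_preimJ H g : subgroup H -> subgroup [set x | H (x ^ g)].
Proof.
move=> [H1 HM HV]; split=> /= [|x y Hx Hy|x Hx]; rewrite ?conj1g //.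
  by rewrite conjMg; apply: HM.
by rewrite conjVg; apply: HV.
Qed.

Lemma normal_generated A :
  (forall x g, A x -> generated A (x ^ g)) -> normal_subset (generated A).
Proof.
move=> AJ x g; apply: (generated_sub _ [set x | generated A (x ^ g)]).
  exact: subgroup_preimJ (subgroup_generated A).
by move=> y; apply: AJ.
Qed.

Definition normal_closure K : set G :=
  generated [set z | exists x g, K x /\ z = x ^ g].

Lemma normal_normal_closure K : normal_subset (normal_closure K).
Proof.
apply: normal_generated => _ h [x [g [Kx ->]]]; apply: sub_generated.
by exists x, (g * h); rewrite conjgM.
Qed.

(* [A, G], so that [lower_central n.+1] is [commutatorG (lower_central n)]. *)
Definition commutatorG A : set G :=
  generated [set z | exists x y : G, A x /\ z = [~ x, y]].

Lemma mem_commutatorG A x y : A x -> commutatorG A [~ x, y].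
Proof. by move=> Ax; apply: sub_generated; exists x, y. Qed.

Lemma normal_commutatorG A : normal_subset A -> normal_subset (commutatorG A).
Proof.
move=> nA; apply: normal_generated => _ g [x [y [Ax ->]]].
by rewrite conjRg; apply: mem_commutatorG; apply: nA.
Qed.

Lemma commutatorGS A N : A `<=` N -> commutatorG A `<=` commutatorG N.
Proof.
move=> sAN; apply: generated_sub; first exact: subgroup_generated.
by move=> _ [x [y [Ax ->]]]; apply: mem_commutatorG; apply: sAN.
Qed.

(** * Commutator identities and congruence modulo a normal subgroup *)

Lemma commgMl x y g : [~ x * y, g] = [~ x, g] ^ y * [~ y, g].
Proof. by rewrite /commg /conjg !invgM !mulgA !mulgK. Qed.

Lemma commgMr x g h : [~ x, g * h] = [~ x, h] * [~ x, g] ^ h.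
Proof. by rewrite /commg /conjg !invgM !mulgA !mulgK. Qed.

(** In this form, by [[~ x, g] = x^-1 * x ^ g], a commutator in [N] says that [x] is congruent to
    [x ^ g]. *)
Definition congruent N x y : Prop := N (x^-1 * y).

Section Congruence.
Variable N : set G.
Hypotheses (sN : subgroup N) (nN : normal_subset N).

Lemma congruent_refl x : congruent N x x.
Proof. by rewrite /congruent mulVg; case: sN. Qed.

Lemma congruent_sym x y : congruent N x y -> congruent N y x.
Proof.
have [_ _ NV] := sN.
by rewrite /congruent => /NV; rewrite invgM invgK.
Qed.

Lemma congruent_trans y x z :
  congruent N x y -> congruent N y z -> congruent N x z.
Proof.
have [_ NM _] := sN; rewrite /congruent => Nxy Nyz.
by have := NM _ _ Nxy Nyz; rewrite mulgA mulgK.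
Qed.

Lemma congruentM x y x' y' :
  congruent N x x' -> congruent N y y' -> congruent N (x * y) (x' * y').
Proof.
have [_ NM _] := sN; rewrite /congruent => Nx Ny.
have := NM _ _ (nN _ y Nx) Ny.
by rewrite /conjg invgM !mulgA mulgK.
Qed.

Lemma congruentV x y : congruent N x y -> congruent N x^-1 y^-1.
Proof.
move=> /congruent_sym /(nN _ y^-1).
by rewrite /congruent /conjg !invgK -mulgA mulVKg.
Qed.

Lemma congruentX x y n : congruent N x y -> congruent N (x ^+ n) (y ^+ n).
Proof.
move=> Nxy; elim: n => [|n IHn]; first by rewrite !expg0; apply: congruent_refl.
by rewrite !expgS; apply: congruentM.
Qed.

Lemma congruentJ x g : N [~ x, g] -> congruent N (x ^ g) x.
Proof. by move=> Nxg; apply: congruent_sym; rewrite /congruent -commgEl. Qed.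

Lemma congruentC x g : N [~ x, g] -> congruent N (g * x) (x * g).
Proof. by rewrite /congruent /commg /conjg invgM !mulgA. Qed.

(** As [y] is central modulo [N], each new [y] moves past [x ^+ n]. *)
Lemma congruentXMn x y n : (forall g, N [~ y, g]) ->
  congruent N ((x * y) ^+ n) (x ^+ n * y ^+ n).
Proof.
move=> Cy; elim: n => [|n IHn].
  by rewrite !expg0 mulg1; apply: congruent_refl.
rewrite !expgS.
apply: congruent_trans (congruentM _ _ _ _ (congruent_refl _) IHn) _.
rewrite -!mulgA; apply: congruentM; first exact: congruent_refl.
rewrite !mulgA; apply: congruentM; last exact: congruent_refl.
by apply: congruent_sym; apply: congruentC.
Qed.

(** As [[~ x, g]] is central modulo [N], the conjugation by [y] in [commgMl] disappears. *)
Lemma congruent_commgMl x y g : (forall h, N [~ [~ x, g], h]) ->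
  congruent N [~ x * y, g] ([~ x, g] * [~ y, g]).
Proof.
move=> Cxg; rewrite commgMl; apply: congruentM; last exact: congruent_refl.
exact: congruentJ.
Qed.

Lemma congruent_commgMr x g h : (forall h, N [~ [~ x, g], h]) ->
  congruent N [~ x, g * h] ([~ x, h] * [~ x, g]).
Proof.
move=> Cxg; rewrite commgMr; apply: congruentM; first exact: congruent_refl.
exact: congruentJ.
Qed.

Lemma congruent_commXg x g n : (forall h, N [~ [~ x, g], h]) ->
  congruent N [~ x ^+ n, g] ([~ x, g] ^+ n).
Proof.
move=> Cxg; elim: n => [|n IHn].
  by rewrite !expg0 comm1g; apply: congruent_refl.
rewrite !expgS; apply: congruent_trans; first exact: congruent_commgMl.
by apply: congruentM => //; apply: congruent_refl.
Qed.

Lemma congruent_commgX x g n : (forall h, N [~ [~ x, g], h]) ->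
  congruent N [~ x, g ^+ n] ([~ x, g] ^+ n).
Proof.
move=> Cxg; elim: n => [|n IHn].
  by rewrite !expg0 commg1; apply: congruent_refl.
rewrite expgS expgSr; apply: congruent_trans; first exact: congruent_commgMr.
by apply: congruentM => //; apply: congruent_refl.
Qed.

End Congruence.

(** Some positive power of [x] lies in the product set [K N]. *)
Definition power_in_mod K N x : Prop :=
  exists n k, [/\ (0 < n)%N, K k & congruent N k (x ^+ n)].

(** * Powers of elements of the normal closure that fall into [K] *)

Section PowersInKernel.
Variables K H : set G.
Hypotheses (sK : subgroup K) (KJ : forall x h, K x -> H h -> K (x ^ h)).
Hypothesis powH : forall g, exists n, (0 < n)%N /\ H (g ^+ n).

Lemma power_in_mod_commutatorG A :
    normal_subset A ->
    (forall a, A a -> power_in_mod (K `&` A) (commutatorG A) a) ->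
  forall b, commutatorG A b ->
    power_in_mod (K `&` commutatorG A) (commutatorG (commutatorG A)) b.
Proof.
move=> nA powA; pose B := commutatorG A; pose C := commutatorG B.
have sB : subgroup B by apply: subgroup_generated.
have nB : normal_subset B by apply: normal_commutatorG.
have sC : subgroup C by apply: subgroup_generated.
have nC : normal_subset C by apply: normal_commutatorG.
have [K1 KM KV] := sK; have [B1 BM BV] := sB.
have cB b g : B b -> C [~ b, g] by apply: mem_commutatorG.
have cA a g h : A a -> C [~ [~ a, g], h].
  by move=> Aa; apply: cB; apply: mem_commutatorG.
(* [B] is central modulo [C], so powers multiply there and the good elements form a subgroup. Only
   the generators [[~ a, g]] then need a witness. *)
suff sP : subgroup [set b | B b /\ power_in_mod (K `&` B) C b].
  move=> b /(generated_sub _ _ sP) /=; case=> // _ [a [g [Aa ->]]].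
  split; first exact: mem_commutatorG.
  have [n [k [n0 [Kk Ak] ckan]]] := powA _ Aa; have [M [M0 HgM]] := powH g.
  (* Modulo [C], [[~ a, g] ^+ (n * M)] is [[~ a ^+ n, g] ^+ M], then [[~ k, g] ^+ M], then
     [[~ k, g ^+ M]]. The last is [k^-1 * k ^ (g ^+ M)], in [K] because [g ^+ M] is in [H]. *)
  exists (n * M)%N, [~ k, g ^+ M]; split; first by rewrite muln_gt0 n0.
    split; last exact: mem_commutatorG.
    by rewrite commgEl; apply: KM; [apply: KV | apply: KJ].
  apply: (congruent_trans _ sC ([~ k, g] ^+ M)).
    by apply: (congruent_commgX _ sC nC) => // h; apply: cA.
  rewrite expgnA; apply: (congruentX _ sC nC) => //.
  apply: (congruent_trans _ sC [~ a ^+ n, g]); last first.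
    by apply: (congruent_commXg _ sC nC) => // h; apply: cA.
  (* Split [a ^+ n] as [k] times an element of [B], whose commutator with [g] lies in [C]. *)
  rewrite -(mulVKg k (a ^+ n)); apply: (congruent_sym _ sC) => //.
  apply: (congruent_trans _ sC) => //.
    by apply: (congruent_commgMl _ sC nC) => // h; apply: cA.
  rewrite -[X in congruent C _ X]mulg1; apply: (congruentM _ sC nC) => //.
    exact: (congruent_refl _ sC).
  by apply: (congruent_sym _ sC) => //; rewrite /congruent invg1 mul1g; apply: cB.
split=> /=.
- split=> //; exists 1%N, 1; split=> //.
  by rewrite expg1; apply: (congruent_refl _ sC).
- move=> b b' [Bb [n [k [n0 [Kk Bk] ckb]]]] [Bb' [n' [k' [n'0 [Kk' Bk'] ckb']]]].
  split; first exact: BM.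
  exists (n * n')%N, (k ^+ n' * k' ^+ n); split; first by rewrite muln_gt0 n0.
    by split; [apply: KM; apply: (subgroupX _ _ _ sK)
              | apply: BM; apply: (subgroupX _ _ _ sB)].
  apply: (congruent_trans _ sC (b ^+ (n * n') * b' ^+ (n * n'))).
    apply: (congruentM _ sC nC) => //.
      by rewrite expgnA; apply: (congruentX _ sC nC).
    by rewrite mulnC expgnA; apply: (congruentX _ sC nC).
  apply: (congruent_sym _ sC) => //.
  by apply: (congruentXMn _ sC nC) => // g; apply: cB.
- move=> b [Bb [n [k [n0 [Kk Bk] ckb]]]]; split; first exact: BV.
  exists n, k^-1; split=> //; first by split; [apply: KV | apply: BV].
  by rewrite expVgn; apply: (congruentV _ sC nC).
Qed.

(** Exponent 1 suffices: a generator [x ^ g] is [x * [~ x, g]], hence congruent to [x] in [K]. *)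
Lemma power_in_mod_normal_closure a : normal_closure K a ->
  power_in_mod (K `&` normal_closure K) (commutatorG (normal_closure K)) a.
Proof.
pose A := normal_closure K; pose B := commutatorG A.
have [K1 KM KV] := sK.
have sB : subgroup B by apply: subgroup_generated.
have nB : normal_subset B by apply: normal_commutatorG; apply: normal_normal_closure.
have KA : K `<=` A.
  by move=> x Kx; apply: sub_generated; exists x, 1; rewrite conjg1.
suff PA : A `<=` [set a | exists2 k, K k & congruent B k a].
  move=> /PA [k Kk cka]; exists 1%N, k.
  by split; [| split=> //; apply: KA | rewrite expg1].
apply: generated_sub => [|_ [x [g [Kx ->]]]]; last first.
  by exists x => //; rewrite /congruent -commgEl; apply: mem_commutatorG; apply: KA.
split=> /=.
- by exists 1 => //; apply: (congruent_refl _ sB).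
- move=> x y [k Kk ckx] [l Kl cly]; exists (k * l); first exact: KM.
  exact: (congruentM _ sB nB).
- by move=> x [k Kk ckx]; exists k^-1; [apply: KV | apply: (congruentV _ sB nB)].
Qed.

Hypothesis nilG : nilpotent_group G.

Lemma power_in_of_normal_closure a : normal_closure K a ->
  exists n, (0 < n)%N /\ K (a ^+ n).
Proof.
pose A i := iter i commutatorG (normal_closure K).
have sA i : subgroup (A i) by case: i => [|i]; apply: subgroup_generated.
have nA i : normal_subset (A i).
  elim: i => [|i IHi]; first exact: normal_normal_closure.
  exact: normal_commutatorG.
have powA i b : A i b -> power_in_mod (K `&` A i) (A i.+1) b.
  elim: i b => [|i IHi]; first exact: power_in_mod_normal_closure.
  exact: power_in_mod_commutatorG.
have sAlc i : A i `<=` lower_central i.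
  by elim: i => [//|i IHi]; apply: commutatorGS.
have [_ KM _] := sK.
move=> Aa; have powa i : power_in_mod K (A i) a.
  elim: i => [|i [n [k [n0 Kk ckan]]]].
    (* Both [k] and [a ^+ n] lie in [A 0], so they are congruent modulo it. *)
    have [n [k [n0 [Kk Ak] _]]] := powA 0 _ Aa; exists n, k; split=> //.
    have [_ AM AV] := sA 0.
    by apply: AM; [apply: AV | apply: (subgroupX _ _ _ (sA 0))].
  (* Write [a ^+ n = k * u] with [u] in [A i], central modulo [A i.+1]. Then [a ^+ (n * r)] is
     congruent to [k ^+ r * u ^+ r], hence to [k ^+ r * l]. *)
  have [r [l [r0 [Kl _] clr]]] := powA i _ ckan.
  exists (n * r)%N, (k ^+ r * l); split; first by rewrite muln_gt0 n0.
    by apply: KM => //; apply: (subgroupX _ _ _ sK).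
  rewrite expgnA -[a ^+ n](mulVKg k).
  apply: (congruent_trans _ (sA i.+1)) => //.
    by apply: (congruentM _ (sA i.+1) (nA i.+1)) clr => //; apply: (congruent_refl _ (sA i.+1)).
  apply: (congruent_sym _ (sA i.+1)) => //; apply: (congruentXMn _ (sA i.+1) (nA i.+1)) => // g.
  exact: mem_commutatorG.
have [c lc1] := nilG; have [n [k [n0 Kk /sAlc]]] := powa c.
rewrite lc1 /= => eq1; exists n; split=> //.
by rewrite -[a ^+ n](mulVKg k) eq1 mulg1.
Qed.

End PowersInKernel.

(** * Consequences of finite index *)

Section FiniteIndex.
Variables (H : set G) (m : nat).
Hypotheses (sH : subgroup H) (indexH : has_index H m).

(** Numbering the right cosets turns the cardinality hypothesis into a map to ['I_m], ready for
    pigeonhole and for induction on indices. *)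
Lemma coset_index : exists i : G -> 'I_m, forall x y, i x = i y -> H (x * y^-1).
Proof.
have [H1 HM HV] := sH.
pose coset x : set G := [set h * x | h in H].
have cosetP x : right_cosets H (coset x) by exists x.
have /pcard_eqP/unsquash F := indexH.
have lt_m x : (F (coset x) < m)%N by apply: (@funS _ _ _ _ F); apply: cosetP.
exists (fun x => Ordinal (lt_m x)) => x y [] eqF.
have eqc : coset x = coset y.
  by apply: (@inj _ _ _ F) eqF; rewrite inE; apply: cosetP.
have : coset x x by exists 1 => //; rewrite mul1g.
by rewrite eqc => -[h Hh <-]; rewrite mulgK.
Qed.

Lemma finite_index_power g : exists n, (0 < n)%N /\ H (g ^+ n).
Proof.
have [i iP] := coset_index.
have [p [q [lt_pq eq_pq]]] :
    exists p q : nat, (p < q)%N /\ i (g ^+ q) = i (g ^+ p).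
  (* Pigeonhole: the [m.+1] powers [g ^+ 0], ..., [g ^+ m] share at most [m] indices. *)
  have /injectivePn[p [q neq_pq eq_pq]] :
      ~~ injectiveb (fun p : 'I_m.+1 => i (g ^+ p)).
    apply/negP => /injectiveP /leq_card; by rewrite !card_ord ltnn.
  have [lt_pq|lt_qp|/val_inj eqpq] := ltngtP p q.
  - by exists p, q.
  - by exists q, p.
  - by rewrite eqpq eqxx in neq_pq.
exists (q - p)%N; rewrite subn_gt0; split=> //.
by rewrite expgnFr ?(ltnW lt_pq) //; apply: iP.
Qed.

Lemma finite_index_power_core K x : subgroup K ->
    (forall y h, K y -> H h -> K (y ^ h)) ->
    (forall g, exists n, (0 < n)%N /\ K ((x ^ g) ^+ n)) ->
  exists n, (0 < n)%N /\ forall g, K ((x ^+ n) ^ g).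
Proof.
move=> sK KJ powx; have [i iP] := coset_index.
(* For [h] in [H], [y ^ g] in [K] gives [y ^ (g * h)] in [K], so only the left coset [g H] matters.
   As [i] numbers right cosets, it is applied to [g^-1]. *)
suff [n [n0 Kn]] : exists n, (0 < n)%N /\
    forall g, (i g^-1 < m)%N -> K ((x ^+ n) ^ g).
  by exists n; split=> // g; apply: Kn.
(* Only the bound varies, the type ['I_m] staying fixed. Each new coset multiplies the exponent by
   one that works for a representative; an index that is not attained costs nothing. *)
elim: {2}m => [|p [n [n0 Kn]]]; first by exists 1%N.
have [[g ig]|noi] := pselect (exists g, i g^-1 = p :> nat); last first.
  exists n; split=> // g; rewrite ltnS leq_eqVlt => /orP[/eqP ig|/Kn//].
  by case: noi; exists g.
have [r [r0 Kr]] := powx g; exists (n * r)%N; split=> [|g'].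
  by rewrite muln_gt0 n0.
rewrite ltnS leq_eqVlt => /orP[/eqP ig'|/Kn Kg']; last first.
  by rewrite expgnA conjXg; apply: (subgroupX _ _ _ sK).
have /iP : i g^-1 = i g'^-1 by apply: val_inj; rewrite /= ig ig'.
rewrite invgK => Hgg'; rewrite -(mulVKg g g') conjgM mulnC expgnA.
rewrite !conjXg; apply: (subgroupX _ _ _ sK) => //.
rewrite -conjXg; exact: KJ.
Qed.

End FiniteIndex.

End SubgroupTheory.

(** * The kernel and the largest normal subgroup of [G] inside it *)

Theorem theorem1 (G : groupType) (nilG : nilpotent_group G)
    (H : set G) (subH : subgroup H) (m : nat) (indexH : has_index H m)
    (f : G -> G) (homf : homomorphism_on H f)
    (L : set G) (coreL : is_fcore H f L) :
  kernel_on H f `<=` isolator H L.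
Proof.
have [H1 HM HV] := subH.
have f1 : f 1 = 1 by apply: (@mulgI _ (f 1)); rewrite -homf // !mulg1.
have fV x : H x -> f x^-1 = (f x)^-1.
  move=> Hx; apply: (@mulgI _ (f x)).
  by rewrite -homf ?mulgV //; apply: HV.
pose K := kernel_on H f.
have sK : subgroup K.
  split=> [//|x y [Hx fx] [Hy fy]|x [Hx fx]].
    by split; [apply: HM | rewrite homf // fx fy mulg1].
  by split; [apply: HV | rewrite fV // fx invg1].
have KJ x h : K x -> H h -> K (x ^ h).
  move=> [Hx fx] Hh; have HVh := HV _ Hh; have Hxh := HM _ _ Hx Hh.
  by split; [apply: HM | rewrite /conjg !homf // fx fV // mul1g mulVg].
have powH := finite_index_power G H m subH indexH.
move=> x Kx; split; first by case: Kx.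
have powx g : exists n, (0 < n)%N /\ K ((x ^ g) ^+ n).
  apply: (power_in_of_normal_closure _ _ _ sK KJ powH nilG).
  by apply: sub_generated; exists x, g.
have [n [n0 Kxn]] := finite_index_power_core _ _ _ subH indexH _ _ sK KJ powx.
exists n; split=> //; have [_ maxL] := coreL.
(* The intersection of all conjugates of [K]. Its image under [f] is trivial, which makes it
   [f]-invariant. *)
pose C := [set y | forall g, K (y ^ g)].
have CK : C `<=` K by move=> y /(_ 1); rewrite conjg1.
have C1 : C 1 by move=> g; rewrite conj1g; case: sK.
apply: (maxL C) => //; split.
- split=> // [y z Cy Cz g|y Cy g].
    by have [_ KM _] := sK; rewrite conjMg; apply: KM.
  by have [_ _ KV] := sK; rewrite conjVg; apply: KV.
- by move=> y /CK [].
- by move=> y g Cy h; rewrite -conjgM.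
- by move=> _ [y /CK [_ fy] <-]; rewrite fy.
Qed.
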